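(* Let $G$ be a circulant graph such that ${\rm Ind}(G)$ is vertex decomposable, respectively shellable. Then for every $m\geq 1$, the lexicographical product $G[K_m]$ is a circulant graph whose independence complex ${\rm Ind}(G[K_m])$ is also vertex decomposable, respectively shellable.
   Context: For $n\ge 1$ and $S\subseteq\{1,2,\ldots,\lfloor n/2\rfloor\}$, the circulant graph $C_n(S)$ has vertex set $\{x_0,\ldots,x_{n-1}\}$, with $\{x_a,x_b\}$ an edge iff $|a-b|\in S$ or $n-|a-b|\in S$; a circulant graph is a graph of this form. For graphs $G=(V_G,E_G)$, $H=(V_H,E_H)$, the lexicographical product $G[H]$ has vertex set $V_G\times V_H$, with $(w,x)$ and $(y,z)$ adjacent if $\{w,y\}\in E_G$, or if $w=y$ and $\{x,z\}\in E_H$. $K_m$ is the complete graph on $m$ vertices. ${\rm Ind}(G)$ is the simplicial complex of independent sets of $G$. A pure simplicial complex $\Delta$ is shellable if its facets (maximal faces) can be ordered $F_1,\ldots,F_s$ so that for all $1\le j<i\le s$ there exist $x\in F_i\setminus F_j$ and $k<i$ with $\{x\}=F_i\setminus F_k$. A pure simplicial complex $\Delta$ is vertex decomposable if it has a unique facet, or there is a vertex $x$ such that ${\rm del}_\Delta(x)=\{F\in\Delta: x\notin F\}$ and ${\rm link}_\Delta(x)=\{F\in\Delta: x\notin F,\ F\cup\{x\}\in\Delta\}$ are vertex decomposable. *)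

(* Defs.v *)
From mathcomp Require Import all_boot all_order all_algebra.

Set Implicit Arguments.
Unset Strict Implicit.
Unset Printing Implicit Defensive.

Record sgraph := SGraph {
  vertex :> finType;
  edge : rel vertex;
  edge_sym : symmetric edge;
  edge_irr : irreflexive edge }.

Definition graph_iso (G H : sgraph) : Prop :=
  exists f : G -> H, bijective f /\ forall x y, edge (f x) (f y) = edge x y.

Section Circulant.
Import IntDist.
Variables (n : nat) (S : {pred nat}).
Hypothesis n_gt0 : 1 <= n.
Hypothesis S_sub : {subset S <= [pred s | 1 <= s <= n %/ 2]}.

(* For a, b < n the subtraction n - |a - b| is never truncated. *)
Definition circulant_edge (a b : 'I_n) : bool :=
  (`|a - b|%N \in S) || (n - `|a - b|%N \in S).

Lemma circulant_edge_sym : symmetric circulant_edge.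
Proof. by move=> a b; rewrite /circulant_edge distnC. Qed.

Lemma circulant_edge_irr : irreflexive circulant_edge.
Proof.
move=> a; rewrite /circulant_edge distnn subn0; apply/negP=> /orP[] /S_sub //.
by rewrite inE n_gt0 /= leqNgt ltn_Pdiv.
Qed.

Definition circulant_graph : sgraph :=
  SGraph circulant_edge_sym circulant_edge_irr.
End Circulant.

(* Being circulant is understood up to isomorphism: the vertices of G[K_m] are
   pairs, so it can only be some C_n(S) after relabelling. *)
Definition circulant (G : sgraph) : Prop :=
  exists (n : nat) (S : {pred nat}) (n_gt0 : 1 <= n)
         (S_sub : {subset S <= [pred s | 1 <= s <= n %/ 2]}),
    graph_iso G (circulant_graph n_gt0 S_sub).

Section LexProduct.
Variables G H : sgraph.

Definition lex_edge (p q : G * H) : bool :=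
  edge p.1 q.1 || (p.1 == q.1) && edge p.2 q.2.

Lemma lex_edge_sym : symmetric lex_edge.
Proof.
by move=> p q; rewrite /lex_edge edge_sym eq_sym [edge p.2 _]edge_sym.
Qed.

Lemma lex_edge_irr : irreflexive lex_edge.
Proof. by move=> p; rewrite /lex_edge !edge_irr andbF. Qed.

Definition lex_product : sgraph := SGraph lex_edge_sym lex_edge_irr.
End LexProduct.

Section Complete.
Variable m : nat.

Definition complete_edge (i j : 'I_m) : bool := i != j.

Lemma complete_edge_sym : symmetric complete_edge.
Proof. by move=> i j; rewrite /complete_edge eq_sym. Qed.

Lemma complete_edge_irr : irreflexive complete_edge.
Proof. by move=> i; rewrite /complete_edge eqxx. Qed.

Definition complete_graph : sgraph :=
  SGraph complete_edge_sym complete_edge_irr.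
End Complete.

Section Complexes.
Variable T : finType.
Implicit Type D : {set {set T}}.

(* A complex is the set of its faces, the empty face included; its vertices are
   the x with [set x] \in D, which need not be all of T. *)
Definition simplicial_complex D : Prop :=
  set0 \in D /\ forall E F : {set T}, F \in D -> E \subset F -> E \in D.

Definition facets D : {set {set T}} :=
  [set F : {set T} | maxset (fun A : {set T} => A \in D) F].

Definition pure D : Prop :=
  {in facets D &, forall E F : {set T}, #|E| = #|F|}.

Definition pure_complex D : Prop := simplicial_complex D /\ pure D.

Definition del D (x : T) : {set {set T}} := [set F in D | x \notin F].

Definition link D (x : T) : {set {set T}} :=
  [set F in D | (x \notin F) && (x |: F \in D)].

Inductive vertex_decomposable : {set {set T}} -> Prop :=
| vd_simplex D :
    pure_complex D -> #|facets D| = 1 -> vertex_decomposable D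
| vd_shed D (x : T) :
    pure_complex D -> [set x] \in D ->
    vertex_decomposable (del D x) -> vertex_decomposable (link D x) ->
    vertex_decomposable D.

Definition shelling (s : seq {set T}) : Prop :=
  forall i j : nat, j < i -> i < size s ->
    exists (x : T) (k : nat),
      [/\ x \in nth set0 s i :\: nth set0 s j, k < i
        & [set x] = nth set0 s i :\: nth set0 s k].

Definition shellable D : Prop :=
  pure_complex D /\
  exists s : seq {set T}, [/\ uniq s, s =i facets D & shelling s].
End Complexes.

Definition independence_complex (G : sgraph) : {set {set G}} :=
  [set A : {set G} | [forall x in A, forall y in A, ~~ edge x y]].

(* Main.v *)
Require Import Defs.
From mathcomp Require Import all_boot all_order all_algebra.
From mathcomp Require Import zify.

(** The faces of Ind(G[K_m]) are the sets on which the projection to G is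
    injective and whose image is a face of Ind(G).  More generally, for a map
    [p : U -> T], a complex [D] on [T] and a set [W] of labels meeting every
    fibre over a vertex of [D], the [A \subset W] that [p] maps injectively onto
    a face of [D] form a complex, the expansion of [D] by [W].

    If [x] is a shedding vertex of [D] and [w] lies over [x], then the link of
    [w] is the expansion of the link of [x], while the deletion of [w] is the
    expansion of [D] by [W :\ w] or, when [w] is the only label over [x], the
    expansion of the deletion of [x]; vertex decomposability follows by
    induction on [D] and on [#|W|].

    When two labels [v] and [w] lie over the same vertex, a shelling for
    [W :\ w] extends to one for [W]: append, in the same order, a copy with [w]
    in place of [v] of each facet containing [v].  Hence shellability reduces to
    the case where [p] is injective on [W], in which a shelling of [D] lifts.

    The map (a, i) |-> a + n i identifies C_n(S)[K_m] with a circulant graph on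
    m n vertices: whether x and y are adjacent in C_n(S) only depends on their
    difference up to sign modulo n. *)

Set Implicit Arguments.
Unset Strict Implicit.
Unset Printing Implicit Defensive.

Section Complexes.
Variable T : finType.
Implicit Types (D : {set {set T}}) (A B F : {set T}).

Lemma facet_face D F : F \in facets D -> F \in D.
Proof. by rewrite inE => /maxsetp. Qed.

Lemma facet_exists D A : A \in D -> exists2 F, F \in facets D & A \subset F.
Proof.
by move=> DA; have [F maxF sAF] := @maxset_exists _ (fun B => B \in D) A DA;
  exists F; rewrite // inE.
Qed.

Lemma facet_max D F A : F \in facets D -> A \in D -> F \subset A -> A = F.
Proof. by rewrite inE => /maxsetP[_ maxF] DA /maxF; apply. Qed.

Lemma del_subset D x : del D x \subset D.
Proof. by apply/subsetP=> A; rewrite inE => /andP[]. Qed.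

Lemma link_subset D x : link D x \subset D.
Proof. by apply/subsetP=> A; rewrite inE => /andP[]. Qed.

Lemma facets_powerset F : facets (powerset F) = [set F].
Proof.
apply/setP=> A; rewrite !inE; apply/maxsetP/eqP => [[]|->].
  by rewrite inE => sAF /(_ F) <- //; rewrite inE.
by split=> [|B]; rewrite inE // => sBF sFB; apply/eqP; rewrite eqEsubset sBF.
Qed.

Lemma powerset_pure_complex F : pure_complex (powerset F).
Proof.
split; last by move=> A B; rewrite facets_powerset !inE => /eqP-> /eqP->.
split=> [|A B]; first by rewrite inE sub0set.
by rewrite !inE => sBF sAB; apply: subset_trans sBF.
Qed.

Lemma one_facet_powerset D :
  simplicial_complex D -> #|facets D| = 1 -> exists F, D = powerset F.
Proof.
move=> [_ closedD] /eqP/cards1P[F facetsD]; exists F; apply/setP=> A.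
rewrite inE; apply/idP/idP=> [/facet_exists[B]|sAF].
  by rewrite facetsD inE => /eqP->.
by apply: closedD sAF; apply: facet_face; rewrite facetsD inE.
Qed.

Lemma del_powerset F x : del (powerset F) x = powerset (F :\ x).
Proof. by apply/setP=> A; rewrite !inE subsetD1. Qed.

Lemma link_powerset F x : x \in F -> link (powerset F) x = powerset (F :\ x).
Proof.
move=> Fx; apply/setP=> A; rewrite !inE subsetD1 subUset sub1set Fx /=.
by case: (A \subset F); rewrite ?andbT ?andbF.
Qed.

(* A simplex can itself be shed down to the complex [[set set0]], which is
   therefore the only base case needed. *)
Lemma vertex_decomposable_shed_ind (P : {set {set T}} -> Prop) :
  P (powerset set0) ->
  (forall D x, pure_complex D -> [set x] \in D ->
    P (del D x) -> P (link D x) -> P D) ->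
  forall D, vertex_decomposable D -> P D.
Proof.
move=> P0 Pshed D; elim=> {D}[D [cD _] /(one_facet_powerset cD)[F ->]|].
  have [n] := ubnP #|F|; elim: n F => // n IHn F ltFn.
  have [->//|[x Fx]] := set_0Vmem F.
  have PFx : P (powerset (F :\ x)).
    by apply: IHn; rewrite (cardsD1 x) Fx in ltFn.
  apply: (Pshed _ x); rewrite ?del_powerset ?link_powerset //.
    exact: powerset_pure_complex.
  by rewrite inE sub1set.
by move=> D x pD Dx _ Pdel _ Plink; apply: (Pshed _ x).
Qed.

Definition shelling_step (s : seq {set T}) F : Prop :=
  {in s, forall E, exists x C,
    [/\ x \in F :\: E, C \in s & [set x] = F :\: C]}.

Lemma shelling_rcons s F :
  shelling (rcons s F) <-> shelling s /\ shelling_step s F.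
Proof.
split=> [shell | [shell step] i j ltji].
  split=> [i j ltji ltis | E sE].
    have [|x [k [xij ltki eqx]]] := shell i j ltji.
      by rewrite size_rcons ltnS ltnW.
    rewrite !nth_rcons ltis (ltn_trans ltji ltis) in xij.
    rewrite !nth_rcons ltis (ltn_trans ltki ltis) in eqx.
    by exists x, k.
  have [||x [k [xFE ltk eqx]]] := shell (size s) (index E s).
  - by rewrite index_mem.
  - by rewrite size_rcons.
  rewrite !nth_rcons index_mem sE nth_index // ltnn eqxx in xFE.
  rewrite !nth_rcons ltk ltnn eqxx in eqx.
  by exists x, (nth set0 s k); rewrite mem_nth.
rewrite size_rcons ltnS leq_eqVlt => /predU1P[eqi | ltis].
  rewrite eqi in ltji *.
  have [x [C [xFE sC eqx]]] := step _ (mem_nth set0 ltji).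
  exists x, (index C s).
  by rewrite !nth_rcons index_mem sC nth_index // ltji ltnn eqxx.
have [x [k [xij ltki eqx]]] := shell i j ltji ltis.
exists x, k.
by rewrite !nth_rcons ltis (ltn_trans ltji ltis) (ltn_trans ltki ltis).
Qed.

(* [A] itself settles the old facets; a facet [C] with [A :\: C = [set x]] and
   [x != v] contains [v], and its copy settles the new ones. *)
Lemma shelling_step_twin v w (s r : seq {set T}) A :
  A \in s -> v \in A -> {in s, forall B, w \notin B} -> shelling_step r A ->
  shelling_step (s ++ [seq w |: B :\ v | B <- r & v \in B]) (w |: A :\ v).
Proof.
move=> sA Av nws step E; have nwA := nws A sA.
rewrite mem_cat => /orP[sE | /mapP[B]].
  exists w, A; rewrite !inE eqxx nws // mem_cat sA; split=> //.
  apply/setP=> y; rewrite !inE; have [->|_] := eqVneq y w; first by rewrite nwA.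
  by case: (y \in A); rewrite ?andbF.
rewrite mem_filter => /andP[Bv rB ->].
have [x [C [/setDP[Ax nBx] rC eqx]]] := step B rB.
have nxv : x != v by apply: contraNneq nBx => ->.
have nxw : x != w by apply: contraNneq nwA => <-.
have Cv : v \in C.
  apply: contraT => nCv; have : v \in [set x] by rewrite eqx inE nCv.
  by rewrite inE eq_sym (negbTE nxv).
exists x, (w |: C :\ v); split.
- by rewrite !inE Ax (negbTE nBx) nxv (negbTE nxw).
- rewrite mem_cat (map_f (fun B => w |: B :\ v)) ?orbT //.
  by rewrite mem_filter Cv.
apply/setP=> y; have := congr1 (fun X : {set T} => y \in X) eqx.
rewrite !inE => eqy; have [eqyw|_] := eqVneq y w.
  by rewrite eqyw eq_sym (negbTE nxw).
by have [->|_] := eqVneq y v; rewrite // eq_sym (negbTE nxv).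
Qed.

Lemma shelling_twin v w (s r : seq {set T}) :
  {in s, forall A, w \notin A} -> {subset r <= s} ->
  shelling s -> shelling r ->
  shelling (s ++ [seq w |: A :\ v | A <- r & v \in A]).
Proof.
move=> nws srs shell; elim/last_ind: r srs => [|r A IHr] srs.
  by rewrite cats0.
case/shelling_rcons=> shell_r step; rewrite filter_rcons.
have sub_r : {subset r <= s}.
  by move=> B rB; rewrite srs // mem_rcons inE rB orbT.
have {}IHr := IHr sub_r shell_r.
case: ifP => // Av; rewrite map_rcons -rcons_cat shelling_rcons; split=> //.
by apply: shelling_step_twin; rewrite // srs // mem_rcons mem_head.
Qed.

End Complexes.

Section Expansion.
Variables (U T : finType) (p : U -> T).
Implicit Types (D : {set {set T}}) (W A B C : {set U}) (F : {set T}).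

Lemma imset_swap A a b :
  a \in A -> p b = p a -> p @: (b |: A :\ a) = p @: A.
Proof. by move=> Aa pba; rewrite imsetU1 pba -imsetU1 setD1K. Qed.

Lemma imset_setD1 W w : p w \in p @: (W :\ w) -> p @: (W :\ w) = p @: W.
Proof.
have [Ww pw|nWw _] := boolP (w \in W).
  by rewrite -[in RHS](setD1K Ww) imsetU1 (setUidPr _) // sub1set.
by rewrite (setDidPl _) // disjoint_sym disjoints1.
Qed.

Definition labels_over W F : {set U} := W :&: p @^-1: F.

Lemma imset_labels_over W F : F \subset p @: W -> p @: labels_over W F = F.
Proof.
move=> sFW; apply/setP=> x; apply/imsetP/idP=> [[w /setIP[_]]|Fx].
  by rewrite inE => Fpw ->.
have /imsetP[w Ww eqx] := subsetP sFW x Fx.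
by exists w; rewrite // !inE Ww -eqx.
Qed.

Lemma labels_over_imset W A :
  {in W &, injective p} -> A \subset W -> labels_over W (p @: A) = A.
Proof.
move=> injW sAW; apply/setP=> w; rewrite !inE.
apply/andP/idP=> [[Ww /imsetP[v Av pwv]] | Aw].
  by rewrite (injW w v Ww (subsetP sAW v Av) pwv).
by rewrite (subsetP sAW) ?imset_f.
Qed.

Lemma shelling_labels_over W (s : seq {set T}) :
  {in W &, injective p} -> {in s, forall F, F \subset p @: W} ->
  shelling s -> shelling (map (labels_over W) s).
Proof.
move=> injW sub shell i j ltji; rewrite size_map => ltis.
have [x [k [xij ltki eqx]]] := shell i j ltji ltis.
have lifti := sub _ (mem_nth set0 ltis).
have [Fix nFjx] := setDP xij; have [w Ww eqxw] := imsetP (subsetP lifti x Fix).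
exists w, k.
rewrite !(nth_map set0) ?(ltn_trans ltji ltis) ?(ltn_trans ltki ltis) //.
split=> //; first by rewrite !inE Ww -eqxw Fix nFjx.
apply/setP=> v; have := congr1 (fun X : {set T} => p v \in X) eqx.
rewrite !inE eqxw; have [Wv|nWv _] := boolP (v \in W) => /=.
  by rewrite (inj_in_eq injW).
by apply: contraNF nWv => /eqP->.
Qed.

Definition expansion D W : {set {set U}} :=
  [set A : {set U} | [&& A \subset W, p @: A \in D & #|p @: A| == #|A|]].

Definition fibres_met D W : Prop := {in D, forall F, F \subset p @: W}.

Lemma expansionP D W A :
  reflect [/\ A \subset W, p @: A \in D & {in A &, injective p}]
          (A \in expansion D W).
Proof. by rewrite inE; apply: (iffP and3P) => -[? ? /imset_injP]. Qed.

Lemma card_expansion D W A : A \in expansion D W -> #|p @: A| = #|A|.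
Proof. by rewrite inE => /and3P[_ _ /eqP]. Qed.

Lemma expansion_complex D W :
  simplicial_complex D -> simplicial_complex (expansion D W).
Proof.
move=> [D0 closedD]; split=> [|A B].
  by rewrite inE sub0set imset0 D0 !cards0.
case/expansionP=> sBW DB injB sAB; apply/expansionP; split.
- exact: subset_trans sBW.
- by apply: closedD DB _; apply: imsetS.
- by move=> u v Au Av; apply: injB; apply: (subsetP sAB).
Qed.

Lemma expansion_setU1 D W A w :
  A \in expansion D W -> w \in W -> p w \notin p @: A -> p w |: p @: A \in D ->
  w |: A \in expansion D W.
Proof.
move=> EA Ww npw Dw; have cardA := card_expansion EA.
case/expansionP: EA => sAW _ _; rewrite inE subUset sub1set Ww sAW imsetU1 Dw.
rewrite !cardsU1 npw cardA; suff -> : w \notin A by rewrite eqxx.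
by apply: contra npw; apply: imset_f.
Qed.

Lemma expansion_swap D W A a b :
  A \in expansion D W -> a \in A -> b \in W -> p b = p a ->
  b |: A :\ a \in expansion D W.
Proof.
case/expansionP=> sAW DA injA Aa Wb pba.
rewrite inE imset_swap // DA subUset sub1set Wb.
rewrite (subset_trans (subsetDl _ _) sAW) (card_in_imset injA).
rewrite cardsU1 (cardsD1 a A) Aa; suff -> : b \notin A :\ a by rewrite eqxx.
apply/setD1P=> -[/eqP nba Ab]; exact/nba/injA.
Qed.

Lemma expansion_extend D W A F :
  fibres_met D W -> simplicial_complex D ->
  A \in expansion D W -> p @: A \subset F -> F \in D ->
  exists B, [/\ A \subset B, B \in expansion D W & p @: B = F].
Proof.
move=> metW [_ closedD] EA sAF DF.
have [|B /maxsetP[/andP[EB sBF] maxB] sAB] := @maxset_exists _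
  (fun B => (B \in expansion D W) && (p @: B \subset F)) A.
  by rewrite EA.
exists B; split=> //; apply/eqP; rewrite eqEsubset sBF /=; apply/subsetP=> x Fx.
have /imsetP[w Ww eqx] := subsetP (metW F DF) x Fx; subst x.
apply: contraT => npw.
have swF : p w |: p @: B \subset F by rewrite subUset sub1set Fx.
have EwB : w |: B \in expansion D W.
  by apply: expansion_setU1 => //; apply: closedD swF.
have := maxB (w |: B); rewrite EwB imsetU1 swF subsetUr => /(_ isT isT) eqB.
by case/negP: npw; apply: imset_f; rewrite -eqB setU11.
Qed.

Lemma mem_facets_expansion D W A :
  fibres_met D W -> simplicial_complex D ->
  (A \in facets (expansion D W)) =
    (A \in expansion D W) && (p @: A \in facets D).
Proof.
move=> metW cD; apply/idP/andP=> [fA | [EA fpA]].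
  have EA := facet_face fA; split=> //.
  have [_ DpA _] := expansionP _ _ _ EA.
  have [F fF sAF] := facet_exists DpA.
  have [B [sAB EB pB]] := expansion_extend metW cD EA sAF (facet_face fF).
  by rewrite -(facet_max fA EB sAB) pB.
rewrite inE; apply/maxsetP; split=> // B EB sAB.
have [_ DpB _] := expansionP _ _ _ EB.
have eqp := facet_max fpA DpB (imsetS p sAB).
apply/esym/eqP; rewrite eqEcard sAB.
by rewrite -(card_expansion EA) -(card_expansion EB) eqp /=.
Qed.

Lemma expansion_pure_complex D W :
  fibres_met D W -> pure_complex D -> pure_complex (expansion D W).
Proof.
move=> metW [cD pureD]; split=> [|A B]; first exact: expansion_complex.
rewrite !mem_facets_expansion // => /andP[EA fA] /andP[EB fB].
by rewrite -(card_expansion EA) -(card_expansion EB); apply: pureD.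
Qed.

Lemma fibres_metS D D' W :
  D' \subset D -> fibres_met D W -> fibres_met D' W.
Proof. by move=> /subsetP sD metW F /sD/metW. Qed.

Lemma fibres_met_setD1 D W w :
  p w \in p @: (W :\ w) -> fibres_met D W -> fibres_met D (W :\ w).
Proof. by move=> pw metW F /metW; rewrite imset_setD1. Qed.

Lemma expansion_powerset0 W : expansion (powerset set0) W = powerset set0.
Proof.
apply/setP=> A; rewrite !inE !subset0 imset_eq0.
by have [->|_] := eqVneq A set0; rewrite ?andbF // sub0set imset0 !cards0.
Qed.

Lemma del_expansion D W w : del (expansion D W) w = expansion D (W :\ w).
Proof.
by apply/setP=> A; rewrite !inE subsetD1 -andbA [RHS]andbAC -!andbA;
  do !bool_congr.
Qed.

Lemma expansion_setD1_del D W w :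
  w \in W -> p w \notin p @: (W :\ w) ->
  expansion D (W :\ w) = expansion (del D (p w)) W.
Proof.
move=> Ww npw; apply/setP=> A; rewrite !inE subsetD1.
have [sAW|//] := boolP (A \subset W); rewrite /= -andbA andbCA; congr (_ && _).
congr (~~ _ && _); apply/idP/idP=> [|/imsetP[v Av eqp]]; first exact: imset_f.
apply: contraR npw => nAw; rewrite eqp imset_f // !inE (subsetP sAW) // andbT.
by apply: contraNneq nAw => <-.
Qed.

Lemma link_expansion D W w :
  simplicial_complex D -> w \in W ->
  link (expansion D W) w = expansion (link D (p w)) W.
Proof.
move=> [_ closedD] Ww; apply/setP=> A; rewrite inE.
apply/and3P/expansionP=> [[EA nAw /expansionP[_ DwA injwA]]|].
  have [sAW DA injA] := expansionP _ _ _ EA; split=> //.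
  rewrite inE DA -imsetU1 DwA andbT; apply/imsetP=> -[v Av eqp].
  by case/negP: nAw; rewrite (injwA w v) ?setU11 // !inE Av orbT.
case=> sAW; rewrite inE => /and3P[DA npw DwA] injA.
have EA : A \in expansion D W by apply/expansionP.
split=> //; first by apply: contra npw; apply: imset_f.
exact: expansion_setU1.
Qed.

Lemma expansion_vertex_decomposable D W :
  fibres_met D W -> vertex_decomposable D ->
  vertex_decomposable (expansion D W).
Proof.
move=> metW vdD; move: D vdD W metW.
apply: vertex_decomposable_shed_ind => [W _|D x pD Dx IHdel IHlink W].
  rewrite expansion_powerset0; apply: vd_simplex.
    exact: powerset_pure_complex.
  by rewrite facets_powerset cards1.
have [n] := ubnP #|W|; elim: n W => // n IHn W ltWn metW.
have /imsetP[w Ww eqx] : x \in p @: W by rewrite -sub1set; apply: metW.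
subst x; apply: (@vd_shed _ _ w); first exact: expansion_pure_complex.
- by rewrite inE sub1set Ww imset_set1 Dx !cards1.
- rewrite del_expansion; have [pw|npw] := boolP (p w \in p @: (W :\ w)).
    apply: IHn; last exact: fibres_met_setD1.
    by rewrite (cardsD1 w) Ww in ltWn.
  by rewrite expansion_setD1_del //; apply/IHdel/(fibres_metS (del_subset _ _)).
- rewrite link_expansion //; last by case: pD.
  exact/IHlink/(fibres_metS (link_subset _ _)).
Qed.

Lemma mem_facets_expansion_setD1 D W w A :
  p w \in p @: (W :\ w) -> fibres_met D W -> simplicial_complex D ->
  (A \in facets (expansion D (W :\ w))) =
    (w \notin A) && (A \in facets (expansion D W)).
Proof.
move=> pw metW cD.
rewrite !mem_facets_expansion //; last exact: fibres_met_setD1.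
by rewrite -del_expansion inE -andbA andbCA.
Qed.

Lemma facets_expansion_swap D W A a b :
  fibres_met D W -> simplicial_complex D ->
  A \in facets (expansion D W) -> a \in A -> b \in W -> p b = p a ->
  b |: A :\ a \in facets (expansion D W).
Proof.
move=> metW cD; rewrite !mem_facets_expansion // => /andP[EA fA] Aa Wb pba.
by rewrite imset_swap // fA expansion_swap.
Qed.

Lemma facets_expansion_twin D W v w :
  fibres_met D W -> simplicial_complex D ->
  w \in W -> v \in W :\ w -> p w = p v ->
  facets (expansion D W) =
    facets (expansion D (W :\ w)) :|:
    [set w |: A :\ v | A in facets (expansion D (W :\ w)) & v \in A].
Proof.
move=> metW cD Ww Wv pwv; have [nvw {}Wv] := setD1P Wv.
have pw : p w \in p @: (W :\ w) by rewrite pwv imset_f // !inE nvw.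
have facetsD1 A := mem_facets_expansion_setD1 A pw metW cD.
apply/setP=> A; rewrite in_setU facetsD1.
have [Aw|nAw] := boolP (w \in A); last first.
  case: (boolP (A \in _)) => //= nfA; apply/esym/imsetP=> -[B _ eqA].
  by rewrite eqA setU11 in nAw.
apply/idP/imsetP=> [fA | [B]]; last first.
  rewrite inE => /andP[]; rewrite facetsD1 => /andP[_ fB] Bv ->.
  exact: facets_expansion_swap.
have nAv : v \notin A.
  have [_ _ injA] := expansionP _ _ _ (facet_face fA).
  by apply: contra nvw => Av; apply/eqP/injA.
exists (v |: A :\ w); last by rewrite setU1K ?setD1K // !inE negb_and nAv orbT.
rewrite inE setU11 facetsD1 facets_expansion_swap // !inE.
by rewrite eqxx eq_sym (negbTE nvw).
Qed.

Lemma facets_expansion_inj D W :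
  {in W &, injective p} -> fibres_met D W -> simplicial_complex D ->
  facets (expansion D W) = labels_over W @: facets D.
Proof.
move=> injW metW cD; apply/setP=> A; apply/idP/imsetP=> [|[F fF ->]].
  rewrite mem_facets_expansion // => /andP[/expansionP[sAW _ _] fA].
  by exists (p @: A); rewrite ?labels_over_imset.
have imF := imset_labels_over (metW F (facet_face fF)).
rewrite mem_facets_expansion // imF fF andbT; apply/expansionP.
rewrite subsetIl imF facet_face //; split=> //.
by move=> u v /setIP[Wu _] /setIP[Wv _]; apply: injW.
Qed.

Lemma expansion_shellable_inj D W :
  {in W &, injective p} -> fibres_met D W -> shellable D ->
  shellable (expansion D W).
Proof.
move=> injW metW [pD [s [uniq_s mem_s shell]]]; have [cD _] := pD.
split; first exact: expansion_pure_complex.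
have sub : {in s, forall F, F \subset p @: W}.
  by move=> F; rewrite mem_s => /facet_face/metW.
exists (map (labels_over W) s); split; last exact: shelling_labels_over.
  rewrite map_inj_in_uniq // => E F /sub sE /sub sF eqEF.
  by rewrite -(imset_labels_over sE) eqEF imset_labels_over.
move=> A; rewrite facets_expansion_inj //.
by apply/mapP/imsetP=> -[F fF ->]; exists F; rewrite // ?mem_s // -mem_s.
Qed.

Lemma expansion_shellable_twin D W v w :
  fibres_met D W -> pure_complex D ->
  w \in W -> v \in W :\ w -> p w = p v ->
  shellable (expansion D (W :\ w)) -> shellable (expansion D W).
Proof.
move=> metW pD Ww Wv pwv [_ [s [uniq_s mem_s shell]]]; have [cD _] := pD.
split; first exact: expansion_pure_complex.
have nws : {in s, forall A, w \notin A}.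
  move=> A; rewrite mem_s => /facet_face/expansionP[+ _ _].
  by rewrite subsetD1 => /andP[].
exists (s ++ [seq w |: A :\ v | A <- s & v \in A]); split.
- rewrite cat_uniq uniq_s /=; apply/andP; split.
    apply/hasPn=> _ /mapP[A _ ->].
    by apply: contraL (setU11 w (A :\ v)) => /nws.
  rewrite map_inj_in_uniq ?filter_uniq // => A B.
  rewrite !mem_filter => /andP[Av /nws nwA] /andP[Bv /nws nwB] eqAB.
  rewrite -(setD1K Av) -(setD1K Bv); congr (v |: _).
  rewrite -(@setU1K _ w (A :\ v)) ?eqAB ?setU1K // !inE negb_and.
    by rewrite nwB orbT.
  by rewrite nwA orbT.
- move=> A; rewrite (facets_expansion_twin metW cD Ww Wv pwv) mem_cat inE mem_s.
  congr (_ || _); apply/mapP/imsetP=> -[B].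
    by rewrite mem_filter mem_s => /andP[Bv fB] ->; exists B; rewrite // inE fB.
  by rewrite inE => /andP[fB Bv] ->; exists B; rewrite // mem_filter Bv mem_s.
- exact: shelling_twin.
Qed.

Lemma expansion_shellable D W :
  fibres_met D W -> shellable D -> shellable (expansion D W).
Proof.
move=> metW shD; have [pD _] := shD.
have [n] := ubnP #|W|; elim: n W metW => // n IHn W metW ltWn.
have [/dinjectiveP|/dinjectivePn[w Ww [v Wv pwv]]] := boolP (dinjectiveb p W).
  by move=> injW; apply: expansion_shellable_inj.
have {}Wv : v \in W :\ w by rewrite !inE andbC in Wv *.
apply: (expansion_shellable_twin metW pD Ww Wv pwv); apply: IHn.
  by apply: fibres_met_setD1 => //; rewrite pwv imset_f.
by rewrite (cardsD1 w) Ww in ltWn.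
Qed.

End Expansion.

Lemma independence_complexP (H : sgraph) (A : {set H}) :
  reflect {in A &, forall x y, ~~ edge x y} (A \in independence_complex H).
Proof.
rewrite inE; apply: (iffP forall_inP) => [ind x y Ax | ind x Ax].
  by move/forall_inP: (ind x Ax); apply.
by apply/forall_inP=> y; apply: ind.
Qed.

Section LexComplete.
Variables (G : sgraph) (m : nat).
Let GK := lex_product G (complete_graph m).

Lemma edge_lex_complete (u v : GK) :
  edge u v = (u != v) && ((u.1 == v.1) || edge u.1 v.1).
Proof.
rewrite /= /lex_edge -pair_eqE /= negb_and.
by have [->|_] := eqVneq u.1 v.1; rewrite ?edge_irr ?andbT ?orbF.
Qed.

Lemma independence_complex_lex :
  independence_complex GK =
    expansion (fst : GK -> G) (independence_complex G) setT.
Proof.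
apply/setP=> A; apply/independence_complexP/expansionP => [ind | [_]].
  split; first exact: subsetT.
    apply/independence_complexP=> _ _ /imsetP[u Au ->] /imsetP[v Av ->].
    have := ind u v Au Av; rewrite edge_lex_complete.
    by have [->|_] := eqVneq u v; rewrite ?edge_irr // negb_or => /andP[].
  move=> u v Au Av eq_uv; have := ind u v Au Av.
  by rewrite edge_lex_complete eq_uv eqxx andbT negbK => /eqP.
move=> /independence_complexP ind inj u v Au Av.
rewrite edge_lex_complete negb_and negb_or ind ?imset_f // andbT negbK.
by have [/inj->|_] := eqVneq u.1 v.1; rewrite ?eqxx ?orbT.
Qed.

Lemma fibres_met_lex D : 1 <= m -> fibres_met (fst : GK -> G) D setT.
Proof.
move=> m_gt0 F _; apply/subsetP=> x _; apply/imsetP.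
by exists (x, Ordinal m_gt0).
Qed.

End LexComplete.

Section Circulant.
Import IntDist.

Definition connection (n : nat) (S : {pred nat}) : {pred nat} :=
  [pred d | (d \in S) || (n - d \in S)].

Lemma connection_opp n S d :
  d <= n -> (n - d \in connection n S) = (d \in connection n S).
Proof. by move=> led; rewrite !inE subKn // orbC. Qed.

Definition half_distances (n : nat) (Q : {pred nat}) : {pred nat} :=
  [pred d | (1 <= d <= n %/ 2) && (d \in Q)].

Lemma half_distances_sub n Q :
  {subset half_distances n Q <= [pred d | 1 <= d <= n %/ 2]}.
Proof. by move=> d /andP[]. Qed.

Lemma circulant_edge_half_distances n (Q : {pred nat}) (a b : 'I_n) :
  (forall d, d <= n -> (n - d \in Q) = (d \in Q)) ->
  circulant_edge (half_distances n Q) a b = (a != b) && (`|a - b|%N \in Q).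
Proof.
move=> Q_opp; have ltd : `|a - b|%N < n.
  have lta := ltn_ord a; have ltb := ltn_ord b.
  have [leab|/ltnW leba] := leqP a b; first by rewrite distnEr //; lia.
  by rewrite distnEl //; lia.
rewrite /circulant_edge !inE Q_opp ?(ltnW ltd) // -andb_orl; congr (_ && _).
by rewrite -val_eqE -distn_eq0; move: `|a - b|%N ltd => d ltd; lia.
Qed.

Definition blowup_connection (n : nat) (S : {pred nat}) : {pred nat} :=
  [pred d | (n %| d) || (d %% n \in connection n S)].

Lemma blowup_connection_opp n m S d :
  0 < n -> d <= m * n ->
  (m * n - d \in blowup_connection n S) = (d \in blowup_connection n S).
Proof.
move=> n_gt0 led; rewrite ![_ \in blowup_connection _ _]inE.
rewrite dvdn_subr ?dvdn_mull //.
have [//|ndvd] := boolP (n %| d); rewrite modnB // modnMl addn0 lt0n ndvd mul1n.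
by rewrite connection_opp // ltnW ?ltn_pmod.
Qed.

Lemma blowup_connection_dist n S (u v : nat) :
  0 < n ->
  (`|u - v|%N \in blowup_connection n S) =
  (u == v %[mod n]) || (`|u %% n - v %% n|%N \in connection n S).
Proof.
move=> n_gt0; wlog levu : u v / v <= u => [IH|].
  have [/IH//|/ltnW/IH] := leqP v u.
  by rewrite distnC eq_sym [in RHS]distnC.
rewrite ![_ \in blowup_connection _ _]inE distnEl // -eqn_mod_dvd // modnB //.
congr (_ || _).
have [lt_mod|le_mod] := ltnP (u %% n) (v %% n); last by rewrite distnEl.
have ltv := ltn_pmod v n_gt0; rewrite distnEr ?(ltnW lt_mod) // mul1n.
rewrite -[RHS]connection_opp ?subnBA ?(ltnW lt_mod) //.
by rewrite leq_subLR ltnW ?ltn_addl.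
Qed.

Lemma circulant_lex_complete (G : sgraph) (m : nat) :
  1 <= m -> circulant G -> circulant (lex_product G (complete_graph m)).
Proof.
move=> m_gt0 [n [S [n_gt0 [S_sub [f [bij_f edge_f]]]]]].
have mn_gt0 : 1 <= m * n by rewrite muln_gt0 m_gt0.
exists (m * n), (half_distances (m * n) (blowup_connection n S)), mn_gt0.
exists (@half_distances_sub _ _).
have lt_h (u : G * 'I_m) : u.2 * n + f u.1 < m * n.
  by have := ltn_ord (f u.1); have := ltn_ord u.2; nia.
pose h u : 'I_(m * n) := Ordinal (lt_h u).
have h_mod u : h u %% n = f u.1 by rewrite /= modnMDl modn_small.
have h_div u : h u %/ n = u.2 by rewrite /= divnMDl // divn_small ?addn0.
have inj_h : injective h.
  move=> u v eqh; apply/eqP; rewrite -pair_eqE /=.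
  rewrite -(bij_eq bij_f) -!val_eqE /= -!h_mod -!h_div.
  by rewrite eqh !eqxx.
exists h; split=> [|u v].
  apply: inj_card_bij => //.
  by rewrite card_prod !card_ord (bij_eq_card bij_f) card_ord mulnC.
rewrite edge_lex_complete /= circulant_edge_half_distances; last first.
  by move=> d; apply: blowup_connection_opp.
rewrite blowup_connection_dist // !h_mod (inj_eq inj_h) val_eqE (bij_eq bij_f).
by congr (_ && (_ || _)); apply: edge_f.
Qed.

End Circulant.

Theorem theorem4p2 (G : sgraph) (G_circulant : circulant G) :
  (vertex_decomposable (independence_complex G) ->
   forall m : nat, 1 <= m ->
     circulant (lex_product G (complete_graph m)) /\
     vertex_decomposable
       (independence_complex (lex_product G (complete_graph m)))) /\
  (shellable (independence_complex G) ->
   forall m : nat, 1 <= m ->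
     circulant (lex_product G (complete_graph m)) /\
     shellable (independence_complex (lex_product G (complete_graph m)))).
Proof.
split=> [vG|sG] m m_gt0; split; try exact: circulant_lex_complete;
  rewrite independence_complex_lex.
- by apply: expansion_vertex_decomposable => //; apply: fibres_met_lex.
- by apply: expansion_shellable => //; apply: fibres_met_lex.
Qed.
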